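(* Let $\mathcal C$ be a semi-$\mathcal Z$-prenormal category such that $\mathcal Z$ is also a reflective subcategory of $\mathcal C$. There is a bijective correspondence between characteristic $\mathcal Z$-torsion theories on $\mathcal C$ and (orthogonal) factorisation systems $(\mathscr E,\mathscr M)$ on $\mathcal C$ such that $\mathscr E$ is a class of $\mathcal Z$-normal epimorphisms closed under pullbacks along $\mathcal Z$-normal monomorphisms.
   Context: Let $\mathcal C$ be a category and $\mathcal Z$ a full replete subcategory (the trivial objects). A morphism of $\mathcal C$ is $\mathcal Z$-trivial if it factors through an object of $\mathcal Z$. A $\mathcal Z$-kernel of $f\colon A\to B$ is a pair $(K,k\colon K\to A)$ such that $f\circ k$ is $\mathcal Z$-trivial and every $x\colon X\to A$ with $f\circ x$ $\mathcal Z$-trivial factors uniquely as $x=k\circ x'$. A $\mathcal Z$-cokernel is defined dually. A $\mathcal Z$-normal monomorphism (resp. $\mathcal Z$-normal epimorphism) is a morphism that is a $\mathcal Z$-kernel (resp. $\mathcal Z$-cokernel) of some morphism. A sequence $A\xrightarrow{f}B\xrightarrow{g}C$ is $\mathcal Z$-exact if $(A,f)$ is the $\mathcal Z$-kernel of $g$ and $(C,g)$ is the $\mathcal Z$-cokernel of $f$. $\mathcal C$ is semi-$\mathcal Z$-prenormal if $\mathcal Z$ is mono-coreflective in $\mathcal C$ (the inclusion has a right adjoint and the counit components are monomorphisms) and: (1) $\mathcal C$ has pullbacks along $\mathcal Z$-normal monomorphisms; (2) $\mathcal C$ has $\mathcal Z$-cokernels of $\mathcal Z$-kernels; (3) the pullback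 of a $\mathcal Z$-normal epimorphism along a $\mathcal Z$-normal monomorphism is a $\mathcal Z$-normal epimorphism. A $\mathcal Z$-torsion theory on $\mathcal C$ is a pair $(\mathcal T,\mathcal F)$ of full replete subcategories such that every morphism $A\to B$ with $A\in\mathcal T$, $B\in\mathcal F$ is $\mathcal Z$-trivial, and for every object $X$ there is a $\mathcal Z$-exact sequence $A\to X\to B$ with $A\in\mathcal T$ and $B\in\mathcal F$. Such a sequence is unique up to unique isomorphism; its first morphism is denoted $\tau_X\colon TX\to X$ and called the torsion part of $X$. The $\mathcal Z$-torsion theory is characteristic if for every object $X$ the torsion part $\tau_X$ is a characteristic $\mathcal Z$-normal monomorphism, i.e. for every $\mathcal Z$-normal monomorphism $k\colon K\to TX$ the composite $\tau_X\circ k\colon K\to X$ is again a $\mathcal Z$-normal monomorphism.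
   Formalization: ''Characteristic'' is taken to mean that for every Z-normal monomorphism k: X→Y the composite k∘τ_X is Z-normal, instead of τ_X∘k being Z-normal for every Z-normal k: K→TX; with the latter reading the claim fails (groups 1, A5, A5×A5, C2, A5 wr C2). *)

(* Defs.v *)
From mathcomp Require Import all_boot.

Set Implicit Arguments.
Unset Strict Implicit.
Unset Printing Implicit Defensive.

(** * Categories, functors, adjunctions *)

Record category := Category {
  obj :> Type;
  hom : obj -> obj -> Type;
  idm : forall A, hom A A;
  comp : forall A B D, hom B D -> hom A B -> hom A D;
  comp_idl : forall A B (f : hom A B), comp (idm B) f = f;
  comp_idr : forall A B (f : hom A B), comp f (idm A) = f;
  compA : forall A B D E (h : hom D E) (g : hom B D) (f : hom A B),
    comp h (comp g f) = comp (comp h g) f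
}.

Arguments hom {c} A B.
Arguments idm {c} A.
Arguments comp {c A B D} g f.

Declare Scope cat_scope.
Delimit Scope cat_scope with cat.
Open Scope cat_scope.

Notation "A ~> B" := (hom A B) (at level 70, no associativity) : cat_scope.
Notation "g ∘ f" := (comp g f) (at level 40, left associativity) : cat_scope.

Definition isIso (C : category) (A B : C) (f : A ~> B) : Prop :=
  exists g : B ~> A, g ∘ f = idm A /\ f ∘ g = idm B.

Definition isMono (C : category) (A B : C) (f : A ~> B) : Prop :=
  forall (X : C) (u v : X ~> A), f ∘ u = f ∘ v -> u = v.

Definition isPullback (C : category) (A B D P : C)
    (f : A ~> D) (g : B ~> D) (p : P ~> A) (q : P ~> B) : Prop :=
  f ∘ p = g ∘ q /\
  forall (X : C) (a : X ~> A) (b : X ~> B), f ∘ a = g ∘ b ->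
    exists! u : X ~> P, p ∘ u = a /\ q ∘ u = b.

Record functor (C D : category) := Functor {
  fobj :> C -> D;
  fmap : forall A B : C, A ~> B -> fobj A ~> fobj B;
  fmap_id : forall A : C, fmap (idm A) = idm (fobj A);
  fmap_comp : forall (A B E : C) (g : B ~> E) (f : A ~> B),
    fmap (g ∘ f) = fmap g ∘ fmap f
}.

Record adjunction (C D : category) (L : functor C D) (R : functor D C) :=
  Adjunction {
  unit : forall X : C, X ~> R (L X);
  counit : forall Y : D, L (R Y) ~> Y;
  unit_natural : forall (X X' : C) (f : X ~> X'),
    fmap R (fmap L f) ∘ unit X = unit X' ∘ f;
  counit_natural : forall (Y Y' : D) (g : Y ~> Y'),
    g ∘ counit Y = counit Y' ∘ fmap L (fmap R g);
  triangle_left : forall X : C, counit (L X) ∘ fmap L (unit X) = idm (L X);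
  triangle_right : forall Y : D, fmap R (counit Y) ∘ unit (R Y) = idm (R Y)
}.

(** * Full replete subcategories *)

(* A full subcategory is determined by its class of objects.  By propositional
   extensionality and proof irrelevance, Leibniz equality of such records is
   equality of classes of objects. *)
Record subcategory (C : category) := Subcategory {
  in_sub :> C -> Prop;
  sub_replete : forall (A B : C) (f : A ~> B), isIso f -> in_sub A -> in_sub B
}.

Definition fullsub (C : category) (Z : subcategory C) : category :=
  @Category {X : C | Z X} (fun X Y => sval X ~> sval Y)
    (fun X => idm (sval X)) (fun _ _ _ g f => g ∘ f)
    (fun _ _ f => comp_idl f) (fun _ _ f => comp_idr f)
    (fun _ _ _ _ h g f => compA h g f).

Definition inclusion (C : category) (Z : subcategory C) :
    functor (fullsub Z) C :=
  @Functor (fullsub Z) C (fun X => sval X) (fun _ _ f => f)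
    (fun _ => erefl) (fun _ _ _ _ _ => erefl).

Definition reflective (C : category) (Z : subcategory C) : Prop :=
  exists L : functor C (fullsub Z), inhabited (adjunction L (inclusion Z)).

Definition mono_coreflective (C : category) (Z : subcategory C) : Prop :=
  exists (R : functor C (fullsub Z)) (adj : adjunction (inclusion Z) R),
    forall X : C, isMono (counit adj X).

(** * Kernels and cokernels relative to a class of trivial objects *)

Section Relative.
Context {C : category} (Z : subcategory C).

Definition trivial (A B : C) (f : A ~> B) : Prop :=
  exists (W : C) (u : A ~> W) (v : W ~> B), Z W /\ f = v ∘ u.

Definition isKernel (K A B : C) (k : K ~> A) (f : A ~> B) : Prop :=
  trivial (f ∘ k) /\
  forall (X : C) (x : X ~> A), trivial (f ∘ x) ->
    exists! x' : X ~> K, x = k ∘ x'.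

Definition isCokernel (A B Q : C) (q : B ~> Q) (f : A ~> B) : Prop :=
  trivial (q ∘ f) /\
  forall (X : C) (x : B ~> X), trivial (x ∘ f) ->
    exists! x' : Q ~> X, x = x' ∘ q.

Definition normalMono (K A : C) (k : K ~> A) : Prop :=
  exists (B : C) (f : A ~> B), isKernel k f.

Definition normalEpi (B Q : C) (q : B ~> Q) : Prop :=
  exists (A : C) (f : A ~> B), isCokernel q f.

Definition exact (A B D : C) (f : A ~> B) (g : B ~> D) : Prop :=
  isKernel f g /\ isCokernel g f.

Record semi_prenormal : Prop := SemiPrenormal {
  sp_coreflective : mono_coreflective Z;
  sp_pullback : forall (A B D : C) (f : A ~> D) (m : B ~> D), normalMono m ->
    exists (P : C) (p : P ~> A) (q : P ~> B), isPullback f m p q;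
  sp_cokernel : forall (K A : C) (k : K ~> A), normalMono k ->
    exists (Q : C) (q : A ~> Q), isCokernel q k;
  sp_stable : forall (A B D P : C)
    (e : A ~> D) (m : B ~> D) (p : P ~> A) (q : P ~> B),
    isPullback e m p q -> normalEpi e -> normalMono m -> normalEpi q
}.

(** * Torsion theories *)

Definition torsion_theory (T F : subcategory C) : Prop :=
  (forall (A B : C) (f : A ~> B), T A -> F B -> trivial f) /\
  (forall X : C, exists (A B : C) (f : A ~> X) (g : X ~> B),
     [/\ T A, F B & exact f g]).

(* As for characteristic subgroups: a characteristic subobject of a normal
   subobject is normal.  This is not the condition that normal subobjects of
   [A] be normal in [X]: the latter fails for the perfect radical
   A5 * A5 of the wreath product of A5 by a group of order two, although
   surjections with perfect kernel form the left class of a stable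
   factorisation system on groups. *)
Definition characteristicMono (A X : C) (t : A ~> X) : Prop :=
  normalMono t /\
  forall (Y : C) (k : X ~> Y), normalMono k -> normalMono (k ∘ t).

(* The torsion part of [X] is only defined up to isomorphism; the condition is
   imposed on all of its representatives. *)
Definition characteristic (T F : subcategory C) : Prop :=
  forall (A X B : C) (t : A ~> X) (g : X ~> B),
    T A -> F B -> exact t g -> characteristicMono t.

Record charTorsionTheory := CharTorsionTheory {
  torsion : subcategory C;
  torsionfree : subcategory C;
  ctt_torsion : torsion_theory torsion torsionfree;
  ctt_char : characteristic torsion torsionfree
}.

(** * Factorisation systems *)

Definition morphism_class : Type := forall A B : C, A ~> B -> Prop.

Definition orthogonal (A B X Y : C) (e : A ~> B) (m : X ~> Y) : Prop :=
  forall (u : A ~> X) (v : B ~> Y), v ∘ e = m ∘ u ->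
    exists! d : B ~> X, d ∘ e = u /\ m ∘ d = v.

Record factorisation_system (E M : morphism_class) : Prop :=
  FactorisationSystem {
  fs_isoE : forall (A B : C) (f : A ~> B), isIso f -> E A B f;
  fs_isoM : forall (A B : C) (f : A ~> B), isIso f -> M A B f;
  fs_compE : forall (A B D : C) (g : B ~> D) (f : A ~> B),
    E B D g -> E A B f -> E A D (g ∘ f);
  fs_compM : forall (A B D : C) (g : B ~> D) (f : A ~> B),
    M B D g -> M A B f -> M A D (g ∘ f);
  fs_factor : forall (A B : C) (f : A ~> B),
    exists (I : C) (e : A ~> I) (m : I ~> B), [/\ E A I e, M I B m & f = m ∘ e];
  fs_orthogonal : forall (A B X Y : C) (e : A ~> B) (m : X ~> Y),
    E A B e -> M X Y m -> orthogonal e m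
}.

Definition pullback_stable (E : morphism_class) : Prop :=
  forall (A B D P : C) (e : A ~> D) (m : B ~> D) (p : P ~> A) (q : P ~> B),
    isPullback e m p q -> E A D e -> normalMono m -> E P B q.

Record stableNormalFactSystem := StableNormalFactSystem {
  classE : morphism_class;
  classM : morphism_class;
  snfs_fact : factorisation_system classE classM;
  snfs_normal : forall (A B : C) (f : A ~> B), classE f -> normalEpi f;
  snfs_stable : pullback_stable classE
}.

End Relative.

(* Main.v *)
From mathcomp Require Import all_boot.
From Stdlib Require Import FunctionalExtensionality PropExtensionality.
From Stdlib Require Import ProofIrrelevance.
Require Import Defs.

Set Implicit Arguments.
Unset Strict Implicit.
Unset Printing Implicit Defensive.

(** The correspondence sends a torsion theory [(T, F)] to the pair of classes
    - [E], the normal epimorphisms whose kernel lies in [T],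
    - [M], the morphisms whose kernel lies in [F],
    and a factorisation system [(E, M)] to the classes [T] and [F] of the
    objects that admit an arrow in [E], respectively in [M], to a trivial
    object.  The two constructions undo each other because every arrow from [A]
    to a trivial object has kernel [idm A], while the reflection of [A] is a
    normal epimorphism (lemma [reflection_cokernel]).

    From [(T, F)] to [(E, M)].  To factor [f], take its kernel [k : K ~> A] and
    the torsion part [t : S ~> K] of [K].  Being characteristic, [t] gives a
    normal monomorphism [k ∘ t], whose cokernel [e] is the left factor of
    [f = m ∘ e].  The kernel of [e] is [S], in [T].  Pulling [e] back along the
    kernel [N] of [m] gives a normal epimorphism [K ~> N] with kernel [t], so
    that [N] is the torsion-free quotient of [K] and lies in [F]
    ([ctt_factor]).  Orthogonality says that a morphism from an object of [T]
    to an object of [F] is trivial ([ctt_orthogonal]).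

    From [(E, M)] to [(T, F)].  Kernels are pullbacks along coreflections
    ([kernel_as_pullback]).  Since [E] is stable under such pullbacks, and [M]
    under all of them, kernels of arrows in [E] are in [T] and kernels of arrows
    in [M] are in [F].  The exact sequence of [X] comes from factoring a
    reflection of [X].  The torsion part of [X] is characteristic because, when
    [X] is the kernel of [m ∘ e], the torsion part of [X] is the kernel of [e]
    ([snfs_characteristic]).

    Starting from [(E, M)] and going round, the classes obtained contain [E]
    and [M]; comparable factorisation systems are equal
    ([factorisation_system_eq]). *)

(** * Orthogonality and factorisation systems *)

Section Factorisation.
Context {C : category}.

Lemma pullback_mono (A B D P : C) (f : A ~> D) (m : B ~> D)
    (p : P ~> A) (q : P ~> B) :
  isPullback f m p q -> isMono m -> isMono p.
Proof.
move=> [sq univ] mono_m X u v puv.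
have sqv : f ∘ (p ∘ v) = m ∘ (q ∘ v) by rewrite !compA sq.
have [w [_ w_uniq]] := univ X (p ∘ v) (q ∘ v) sqv.
rewrite -(w_uniq u); first exact: w_uniq.
by split=> //; apply: mono_m; rewrite !compA -sq -!compA puv.
Qed.

Lemma orthogonal_iso (A B X Y : C) (e : A ~> B) (m : X ~> Y) :
  isIso e \/ isIso m -> orthogonal e m.
Proof.
move=> isos u v sq; case: isos => [[g [ge eg]] | [g [gm mg]]].
- exists (u ∘ g); split.
    split; first by rewrite -compA ge comp_idr.
    by rewrite compA -sq -compA eg comp_idr.
  by move=> d [<- _]; rewrite -compA eg comp_idr.
exists (g ∘ v); split.
  split; first by rewrite -compA sq compA gm comp_idl.
  by rewrite compA mg comp_idl.
by move=> d [_ <-]; rewrite compA gm comp_idl.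
Qed.

Lemma orthogonal_comp_left (A B D X Y : C) (g : B ~> D) (f : A ~> B)
    (m : X ~> Y) :
  orthogonal g m -> orthogonal f m -> orthogonal (g ∘ f) m.
Proof.
move=> gm fm u v sq.
have [d [[df md] d_uniq]] := fm u (v ∘ g) (etrans (esym (compA _ _ _)) sq).
have [d' [[d'g md'] d'_uniq]] := gm d v (esym md).
exists d'; split; first by rewrite compA d'g.
move=> c [cgf mc]; apply: d'_uniq; split=> //.
by apply/esym/d_uniq; rewrite -compA cgf compA mc.
Qed.

Lemma orthogonal_comp_right (A B D X Y : C) (g : B ~> D) (f : A ~> B)
    (e : X ~> Y) :
  orthogonal e g -> orthogonal e f -> orthogonal e (g ∘ f).
Proof.
move=> eg ef u v sq.
have [d [[de gd] d_uniq]] := eg (f ∘ u) v (etrans sq (esym (compA _ _ _))).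
have [d' [[d'e fd'] d'_uniq]] := ef u d de.
exists d'; split; first by rewrite -compA fd'.
move=> c [ce gfc]; apply: d'_uniq; split=> //.
by apply/esym/d_uniq; rewrite compA gfc -compA ce.
Qed.

Lemma orthogonal_pullback (A B D P X Y : C) (f : A ~> D) (g : B ~> D)
    (p : P ~> A) (q : P ~> B) (e : X ~> Y) :
  isPullback f g p q -> orthogonal e f -> orthogonal e q.
Proof.
move=> [sq univ] ef u v veq.
have sqf : g ∘ v ∘ e = f ∘ (p ∘ u) by rewrite -compA veq !compA sq.
have [d [[de fd] d_uniq]] := ef _ _ sqf.
have [w [[pw qw] w_uniq]] := univ _ d v fd.
exists w; split.
  split=> //.
  have sqwe : f ∘ (p ∘ u) = g ∘ (q ∘ u) by rewrite !compA sq.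
  have [z [_ z_uniq]] := univ _ (p ∘ u) (q ∘ u) sqwe.
  rewrite -(z_uniq (w ∘ e)); first exact: z_uniq.
  by rewrite !compA pw qw de veq.
move=> c [ce qc]; apply: w_uniq; split=> //.
by apply/esym/d_uniq; rewrite -compA ce !compA sq -compA qc.
Qed.

Section Classes.
Variables E M : morphism_class (C := C).
Hypothesis factor : forall (A B : C) (f : A ~> B),
  exists (I : C) (e : A ~> I) (m : I ~> B), [/\ E e, M m & f = m ∘ e].
Hypothesis orth : forall (A B X Y : C) (e : A ~> B) (m : X ~> Y),
  E e -> M m -> orthogonal e m.

(** Lifting [f = m ∘ e] against its own right factor [m] inverts [m]. *)
Lemma left_class_orthogonal :
  (forall (A B D : C) (i : B ~> D) (e : A ~> B), isIso i -> E e -> E (i ∘ e)) ->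
  forall (A B : C) (f : A ~> B),
    (forall (X Y : C) (m : X ~> Y), M m -> orthogonal f m) -> E f.
Proof.
move=> isoE A B f fM; have [I [e [m [Ee Mm fE]]]] := factor f.
have [d [[df md] _]] := fM _ _ m Mm e (idm B) (etrans (comp_idl f) fE).
have [c [_ c_uniq]] := orth Ee Mm (erefl (m ∘ e)).
rewrite fE; apply: isoE => //; exists d; split=> //.
rewrite -(c_uniq (d ∘ m)); first by apply: c_uniq; rewrite comp_idl comp_idr.
by rewrite -compA -fE df compA md comp_idl.
Qed.

Lemma right_class_orthogonal :
  (forall (A B D : C) (m : B ~> D) (i : A ~> B), isIso i -> M m -> M (m ∘ i)) ->
  forall (A B : C) (f : A ~> B),
    (forall (X Y : C) (e : X ~> Y), E e -> orthogonal e f) -> M f.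
Proof.
move=> isoM A B f fE; have [I [e [m [Ee Mm fme]]]] := factor f.
have [d [[de fd] _]] :=
  fE _ _ e Ee (idm A) m (etrans (esym fme) (esym (comp_idr f))).
have [c [_ c_uniq]] := orth Ee Mm (erefl (m ∘ e)).
rewrite fme; apply: isoM => //; exists d; split=> //.
rewrite -(c_uniq (e ∘ d)); first by apply: c_uniq; rewrite comp_idl comp_idr.
by rewrite -compA de comp_idr compA -fme fd.
Qed.

(** Both classes are determined by orthogonality, which is preserved by
    composition. *)
Lemma factorisation_system_intro :
  (forall (A B D : C) (i : B ~> D) (e : A ~> B), isIso i -> E e -> E (i ∘ e)) ->
  (forall (A B D : C) (m : B ~> D) (i : A ~> B), isIso i -> M m -> M (m ∘ i)) ->
  factorisation_system E M.
Proof.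
move=> isoE isoM; split=> //.
- move=> A B f iso_f; apply: left_class_orthogonal => // X Y m _.
  by apply: orthogonal_iso; left.
- move=> A B f iso_f; apply: right_class_orthogonal => // X Y e _.
  by apply: orthogonal_iso; right.
- move=> A B D g f Eg Ef; apply: left_class_orthogonal => // X Y m Mm.
  by apply: orthogonal_comp_left; apply: orth.
move=> A B D g f Mg Mf; apply: right_class_orthogonal => // X Y e Ee.
by apply: orthogonal_comp_right; apply: orth.
Qed.

End Classes.

Lemma fs_left_orthogonal (E M : morphism_class) (A B : C) (f : A ~> B) :
  factorisation_system E M ->
  (forall (X Y : C) (m : X ~> Y), M X Y m -> orthogonal f m) -> E A B f.
Proof.
case=> isoE _ compE _ fac orth; apply: left_class_orthogonal fac orth _ _ _ _.
by move=> P Q R i e iso_i Ee; apply: compE => //; apply: isoE.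
Qed.

Lemma fs_right_orthogonal (E M : morphism_class) (A B : C) (f : A ~> B) :
  factorisation_system E M ->
  (forall (X Y : C) (e : X ~> Y), E X Y e -> orthogonal e f) -> M A B f.
Proof.
case=> _ isoM _ compM fac orth; apply: right_class_orthogonal fac orth _ _ _ _.
by move=> P Q R m i iso_i Mm; apply: compM => //; apply: isoM.
Qed.

Lemma morphism_class_ext (E E' : morphism_class (C := C)) :
  (forall (A B : C) (f : A ~> B), E A B f <-> E' A B f) -> E = E'.
Proof.
move=> eqE; do 3![apply: functional_extensionality_dep => ?].
exact/propositional_extensionality/eqE.
Qed.

(** Enlarging one class shrinks the other, so both inclusions are equalities. *)
Lemma factorisation_system_eq (E M E' M' : morphism_class (C := C)) :
  factorisation_system E M -> factorisation_system E' M' ->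
  (forall (A B : C) (f : A ~> B), E A B f -> E' A B f) ->
  (forall (A B : C) (f : A ~> B), M A B f -> M' A B f) ->
  E = E' /\ M = M'.
Proof.
move=> fs fs' subE subM; split; apply: morphism_class_ext => A B f.
- split; first exact: subE.
  move=> E'f; apply: (fs_left_orthogonal fs) => X Y m Mm.
  by apply: (fs_orthogonal fs') => //; apply: subM.
split; first exact: subM.
move=> M'f; apply: (fs_right_orthogonal fs) => X Y e Ee.
by apply: (fs_orthogonal fs') => //; apply: subE.
Qed.

Lemma subcategory_ext (S S' : subcategory C) :
  (forall X, S X <-> S' X) -> S = S'.
Proof.
case: S S' => [S repS] [S' repS'] /= eqS.
have eqSS' : S = S'.
  apply: functional_extensionality => X.
  exact/propositional_extensionality/eqS.
by rewrite eqSS' in repS *; congr Subcategory; apply: proof_irrelevance.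
Qed.

End Factorisation.

(** * Relative kernels and cokernels *)

Section Kernels.
Context {C : category} (Z : subcategory C).

Lemma trivial_dom (A B : C) (f : A ~> B) : Z A -> trivial Z f.
Proof. by exists A, (idm A), f; rewrite comp_idr. Qed.

Lemma trivial_cod (A B : C) (f : A ~> B) : Z B -> trivial Z f.
Proof. by exists B, f, (idm B); rewrite comp_idl. Qed.

Lemma trivial_compl (A B D : C) (g : B ~> D) (f : A ~> B) :
  trivial Z f -> trivial Z (g ∘ f).
Proof. by case=> W [u [v [ZW ->]]]; exists W, u, (g ∘ v); rewrite compA. Qed.

Lemma trivial_compr (A B D : C) (g : B ~> D) (f : A ~> B) :
  trivial Z g -> trivial Z (g ∘ f).
Proof. by case=> W [u [v [ZW ->]]]; exists W, (u ∘ f), v; rewrite compA. Qed.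

Lemma kernel_mono (K A B : C) (k : K ~> A) (f : A ~> B) :
  isKernel Z k f -> isMono k.
Proof.
move=> [trk univ] X u v kuv.
have [|w [_ w_uniq]] := univ X (k ∘ v).
  by rewrite compA; apply: trivial_compr.
by rewrite -(w_uniq u (esym kuv)); apply: w_uniq.
Qed.

Lemma kernel_lift (K A B X : C) (k : K ~> A) (f : A ~> B) (x : X ~> A) :
  isKernel Z k f -> trivial Z (f ∘ x) -> exists y : X ~> K, x = k ∘ y.
Proof. by move=> [_ univ] /univ [y [xE _]]; exists y. Qed.

Lemma kernel_intro (K A B : C) (k : K ~> A) (f : A ~> B) :
  trivial Z (f ∘ k) -> isMono k ->
  (forall (X : C) (x : X ~> A), trivial Z (f ∘ x) ->
    exists y : X ~> K, x = k ∘ y) ->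
  isKernel Z k f.
Proof.
move=> trk mono_k lift; split=> // X x /lift [y ->]; exists y; split=> // z.
exact: mono_k.
Qed.

Lemma cokernel_epi (A B Q X : C) (f : A ~> B) (q : B ~> Q) (u v : Q ~> X) :
  isCokernel Z q f -> u ∘ q = v ∘ q -> u = v.
Proof.
move=> [trq univ] uvq; have [|w [_ w_uniq]] := univ X (v ∘ q).
  by rewrite -compA; apply: trivial_compl.
by rewrite -(w_uniq u (esym uvq)); apply: w_uniq.
Qed.

Lemma cokernel_desc (A B Q X : C) (f : A ~> B) (q : B ~> Q) (x : B ~> X) :
  isCokernel Z q f -> trivial Z (x ∘ f) -> exists y : Q ~> X, x = y ∘ q.
Proof. by move=> [_ univ] /univ [y [xE _]]; exists y. Qed.

Lemma kernel_replete (S : subcategory C) (K K' A B : C)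
    (k : K ~> A) (k' : K' ~> A) (f : A ~> B) :
  isKernel Z k f -> isKernel Z k' f -> S K -> S K'.
Proof.
move=> kerk kerk'; have [i iE] := kernel_lift kerk' kerk.1.
have [j jE] := kernel_lift kerk kerk'.1.
apply: (@sub_replete _ S _ _ i); exists j; split.
  by apply: (kernel_mono kerk); rewrite compA -jE -iE comp_idr.
by apply: (kernel_mono kerk'); rewrite compA -iE -jE comp_idr.
Qed.

Lemma cokernel_replete (S : subcategory C) (A B Q Q' : C)
    (f : A ~> B) (q : B ~> Q) (q' : B ~> Q') :
  isCokernel Z q f -> isCokernel Z q' f -> S Q -> S Q'.
Proof.
move=> cokq cokq'; have [i iE] := cokernel_desc cokq cokq'.1.
have [j jE] := cokernel_desc cokq' cokq.1.
apply: (@sub_replete _ S _ _ i); exists j; split.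
  by apply: (cokernel_epi cokq); rewrite -compA -iE -jE comp_idl.
by apply: (cokernel_epi cokq'); rewrite -compA -jE -iE comp_idl.
Qed.

Lemma kernel_of_trivial (A B : C) (f : A ~> B) :
  trivial Z f -> isKernel Z (idm A) f.
Proof.
move=> trf; apply: kernel_intro; first by rewrite comp_idr.
  by move=> X u v; rewrite !comp_idl.
by move=> X x _; exists x; rewrite comp_idl.
Qed.

Lemma normalEpi_cokernel (K A B : C) (k : K ~> A) (e : A ~> B) :
  normalEpi Z e -> isKernel Z k e -> isCokernel Z e k.
Proof.
move=> [H [h cok]] kerk; split; first exact: kerk.1.
move=> X x trx; apply: cok.2.
have [y ->] := kernel_lift kerk cok.1.
by rewrite compA; apply: trivial_compr.
Qed.

Lemma normalMono_kernel (K A Q : C) (k : K ~> A) (q : A ~> Q) :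
  normalMono Z k -> isCokernel Z q k -> isKernel Z k q.
Proof.
move=> [B [f ker]] cok; split; first exact: cok.1.
move=> X x trx; apply: ker.2.
have [y ->] := cokernel_desc cok ker.1.
by rewrite -compA; apply: trivial_compl.
Qed.

(** Normal monomorphisms play the part of subobjects containing zero: since
    every map out of a trivial object is trivial, it factors through any
    kernel. *)
Lemma normalMono_lift_trivial (K A X : C) (k : K ~> A) (x : X ~> A) :
  normalMono Z k -> trivial Z x ->
  exists y : X ~> K, trivial Z y /\ x = k ∘ y.
Proof.
move=> [B [f ker]] [W [u [v [ZW ->]]]].
have [w ->] := kernel_lift ker (trivial_dom (f ∘ v) ZW).
by exists (w ∘ u); split; [exists W, u, w | rewrite compA].
Qed.

(** As in pointed categories, pulling back does not change the kernel object;
    what replaces the zero map into [B] is a lift of the trivial [e ∘ k]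
    through the normal monomorphism [m]. *)
Lemma pullback_kernel (A B D P K : C) (e : A ~> D) (m : B ~> D)
    (p : P ~> A) (q : P ~> B) (k : K ~> A) :
  isPullback e m p q -> normalMono Z m -> isKernel Z k e ->
  exists s : K ~> P, isKernel Z s q /\ p ∘ s = k.
Proof.
move=> pb nm kerk; have [b [trb ekb]] := normalMono_lift_trivial nm kerk.1.
have [s [[psk qsb] _]] := pb.2 _ _ _ ekb.
have mono_p : isMono p.
  by have [V [g kerm]] := nm; apply: pullback_mono pb (kernel_mono kerm).
exists s; split=> //; apply: kernel_intro.
- by rewrite qsb.
- move=> X u v suv; apply: (kernel_mono kerk).
  by rewrite -psk -!compA suv.
move=> X x trx; have [|y pxy] := @kernel_lift _ _ _ X k e (p ∘ x) kerk.
  by rewrite compA pb.1 -compA; apply: trivial_compl.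
by exists y; apply: mono_p; rewrite pxy compA psk.
Qed.

(** Restricting [e] to the kernel of [m ∘ e] pulls it back along the kernel of
    [m]; stability of normal epimorphisms then controls this restriction. *)
Lemma kernel_comp_pullback (A I B K N : C) (e : A ~> I) (m : I ~> B)
    (k : K ~> A) (n : N ~> I) :
  isKernel Z k (m ∘ e) -> isKernel Z n m ->
  exists e' : K ~> N, isPullback e n k e'.
Proof.
move=> kerk kern; have [|e' eE] := @kernel_lift _ _ _ K n m (e ∘ k) kern.
  by rewrite compA; apply: kerk.1.
exists e'; split=> // X a b sq.
have [|y aE] := @kernel_lift _ _ _ X k (m ∘ e) a kerk.
  by rewrite -compA sq compA; apply: trivial_compr kern.1.
exists y; split.
  split=> //; apply: (kernel_mono kern).
  by rewrite -sq aE !compA eE.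
by move=> z [kz _]; apply: (kernel_mono kerk); rewrite -aE kz.
Qed.

End Kernels.

(** * Coreflections and reflections *)

Section Prenormal.
Context {C : category} (Z : subcategory C) (hC : semi_prenormal Z).

Lemma coreflection_kernel (B : C) :
  exists (W : C) (w : W ~> B), Z W /\ isKernel Z w (idm B).
Proof.
have [R [adj mono_eps]] := sp_coreflective hC.
exists (sval (R B)), (counit adj B); split; first exact: (svalP (R B)).
apply: kernel_intro; last 2 first.
- exact: mono_eps.
- move=> X x; rewrite comp_idl => -[W [u [v [ZW ->]]]].
  pose W' : fullsub Z := exist _ W ZW.
  have nat := @counit_natural _ _ _ _ adj W B v.
  have tri := @triangle_left _ _ _ _ adj W'.
  exists ((fmap R v : sval (R W) ~> sval (R B)) ∘
           (unit adj W' : W ~> sval (R W)) ∘ u).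
  rewrite /= in nat tri; rewrite !compA -nat -(compA v) tri.
  by rewrite comp_idr.
by rewrite comp_idl; apply: trivial_dom; exact: (svalP (R B)).
Qed.

(** A morphism into [B] is trivial exactly when it factors through the
    coreflection of [B], so the kernel of [f : A ~> B] is the pullback of this
    coreflection along [f]. *)
Lemma kernel_as_pullback (A B : C) (f : A ~> B) :
  exists (K W : C) (k : K ~> A) (q : K ~> W) (w : W ~> B),
    [/\ Z W, normalMono Z w, isKernel Z k f & isPullback f w k q].
Proof.
have [W [w [ZW kerw]]] := coreflection_kernel B.
have nw : normalMono Z w by exists B, (idm B).
have [K [k [q pb]]] := sp_pullback hC f nw.
exists K, W, k, q, w; split=> //; apply: kernel_intro.
- by rewrite pb.1; apply: trivial_compr; apply: trivial_dom.
- exact: pullback_mono pb (kernel_mono kerw).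
move=> X x trx; have [|b fxb] := @kernel_lift _ _ _ _ _ X w (idm B) (f ∘ x) kerw.
  by rewrite comp_idl.
by have [y [[<- _] _]] := pb.2 _ _ _ fxb; exists y.
Qed.

(** The factorisation of a trivial [X ~> Y] through the reflection of [X] is
    unique even when [Y] is not trivial: two maps from a trivial object to [Y]
    both factor through the coreflection of [Y], a monomorphism with trivial
    domain, where the universal property of the reflection applies. *)
Lemma reflection_cokernel (hZ : reflective Z) (X : C) :
  exists (W : C) (w : X ~> W), Z W /\ isCokernel Z w (idm X).
Proof.
have [L [adj]] := hZ.
have ZL := svalP (L X).
exists (sval (L X)), (unit adj X); split=> //; split.
  exact: trivial_cod.
have lift (W : fullsub Z) (u : X ~> sval W) :
    exists g : sval (L X) ~> sval W, u = g ∘ unit adj X.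
  have nat := @unit_natural _ _ _ _ adj X (sval W) u.
  have tri := @triangle_right _ _ _ _ adj W.
  exists (counit adj W ∘ fmap L (u : X ~> inclusion Z W)).
  rewrite /= in nat tri *.
  by rewrite -(compA (counit adj W : sval _ ~> sval _)) nat compA tri comp_idl.
have uniq (W : fullsub Z) (g h : sval (L X) ~> sval W) :
    g ∘ unit adj X = h ∘ unit adj X -> g = h.
  (* [g'] is the adjoint transpose of its composite with the unit. *)
  have recover (g' : sval (L X) ~> sval W) :
      g' = counit adj W ∘ fmap L (g' ∘ unit adj X : X ~> inclusion Z W).
    rewrite (fmap_comp L (g' : inclusion Z (L X) ~> inclusion Z W)) compA.
    rewrite -(@counit_natural _ _ _ _ adj (L X) W g') -compA.
    by rewrite (@triangle_left _ _ _ _ adj X) (comp_idr (c := fullsub Z)).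
  by move=> gh; rewrite (recover g) gh -recover.
move=> Y x; rewrite comp_idr => -[W [u [v [ZW ->]]]].
have [g uE] := lift (exist _ W ZW) u; rewrite /= in g uE.
exists (v ∘ g); split; first by rewrite uE compA.
move=> z zE.
have [V [c [ZV kerc]]] := coreflection_kernel Y.
have [y1 vE] := kernel_lift kerc (trivial_dom (idm Y ∘ (v ∘ g)) ZL).
have [y2 zE'] := kernel_lift kerc (trivial_dom (idm Y ∘ z) ZL).
rewrite vE zE'; congr (c ∘ _).
apply: (uniq (exist _ V ZV)) => /=; apply: (kernel_mono kerc).
by rewrite !compA -vE -zE' -zE uE compA.
Qed.

(** * From torsion theories to factorisation systems *)

Definition kernelIn (S : subcategory C) (A B : C) (f : A ~> B) : Prop :=
  exists (K : C) (k : K ~> A), S K /\ isKernel Z k f.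

Definition torsionEpi (T : subcategory C) : morphism_class (C := C) :=
  fun A B e => normalEpi Z e /\ kernelIn T e.

Definition torsionfreeKernel (F : subcategory C) : morphism_class (C := C) :=
  fun A B m => kernelIn F m.

Lemma iso_comp_torsionEpi (T : subcategory C) (A B D : C)
    (i : B ~> D) (e : A ~> B) :
  isIso i -> torsionEpi T e -> torsionEpi T (i ∘ e).
Proof.
move=> [j [ji ij]] [[H [h cok]] [K [k [TK kerk]]]].
have triv_i (X : C) (x : X ~> A) : trivial Z (i ∘ e ∘ x) -> trivial Z (e ∘ x).
  by move=> /(trivial_compl j); rewrite -compA compA ji comp_idl.
split.
- exists H, h; split; first by rewrite -compA; apply: trivial_compl cok.1.
  move=> X x /(cokernel_desc cok) [y ->]; exists (y ∘ j); split.
    by rewrite -compA (compA j) ji comp_idl.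
  move=> z yz; rewrite (_ : y = z ∘ i) -?compA ?ij ?comp_idr //.
  by apply: (cokernel_epi cok); rewrite -compA.
exists K, k; split=> //; split; first by rewrite -compA; apply: trivial_compl kerk.1.
by move=> X x /triv_i; apply: kerk.2.
Qed.

Lemma torsionfreeKernel_comp_iso (F : subcategory C) (A B D : C)
    (m : B ~> D) (i : A ~> B) :
  isIso i -> torsionfreeKernel F m -> torsionfreeKernel F (m ∘ i).
Proof.
move=> [j [ji ij]] [K [k [FK kerk]]]; exists K, (j ∘ k); split=> //.
apply: kernel_intro.
- by rewrite -compA (compA i) ij comp_idl; apply: kerk.1.
- move=> X u v juv; apply: (kernel_mono kerk).
  have -> : k = i ∘ (j ∘ k) by rewrite compA ij comp_idl.
  by rewrite -!(compA i) juv.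
move=> X x; rewrite -compA => /(kernel_lift kerk) [y ixy]; exists y.
by rewrite -compA -ixy compA ji comp_idl.
Qed.

Section FromTorsion.
Context (T F : subcategory C) (TF : torsion_theory Z T F).

Lemma ctt_orthogonal (A B X Y : C) (e : A ~> B) (m : X ~> Y) :
  torsionEpi T e -> torsionfreeKernel F m -> orthogonal e m.
Proof.
move=> [ne [K [k [TK kerk]]]] [N [n [FN kern]]] u v sq.
have cok := normalEpi_cokernel ne kerk.
have [|w ukE] := @kernel_lift _ _ _ _ _ K n m (u ∘ k) kern.
  by rewrite compA -sq -compA; apply: trivial_compl kerk.1.
have truk : trivial Z (u ∘ k) by rewrite ukE; apply/trivial_compl/TF.1.
have [d uE] := cokernel_desc cok truk.
exists d; split.
  split=> //; apply: (cokernel_epi cok).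
  by rewrite -compA -uE.
by move=> c [ce _]; apply: (cokernel_epi cok); rewrite ce.
Qed.

Lemma ctt_factor (charTF : characteristic Z T F) (A B : C) (f : A ~> B) :
  exists (I : C) (e : A ~> I) (m : I ~> B),
    [/\ torsionEpi T e, torsionfreeKernel F m & f = m ∘ e].
Proof.
have [K [_ [k [_ [_ [_ _ kerk _]]]]]] := kernel_as_pullback f.
have [S [Q [t [g [TS FQ tg]]]]] := TF.2 K.
have nk : normalMono Z k by exists B, f.
have nkt : normalMono Z (k ∘ t) := (charTF _ _ _ _ _ TS FQ tg).2 _ _ nk.
have [I [e cok]] := sp_cokernel hC nkt.
have [|m fE] := @cokernel_desc _ _ _ _ _ B (k ∘ t) e f cok.
  by rewrite compA; apply: trivial_compr kerk.1.
have kere := normalMono_kernel nkt cok.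
have ne : normalEpi Z e by exists S, (k ∘ t).
exists I, e, m; split=> //; first by split=> //; exists S, (k ∘ t).
have [N [_ [n [_ [_ [_ _ kern _]]]]]] := kernel_as_pullback m.
have nn : normalMono Z n by exists B, m.
exists N, n; split=> //.
rewrite fE in kerk; have [e' pb] := kernel_comp_pullback kerk kern.
have ne' := sp_stable hC pb ne nn.
have [s [kers /(kernel_mono kerk) st]] := pullback_kernel pb nn kere.
rewrite {}st in kers.
exact: cokernel_replete tg.2 (normalEpi_cokernel ne' kers) FQ.
Qed.

End FromTorsion.

Lemma torsionEpi_stable (T : subcategory C) : pullback_stable Z (torsionEpi T).
Proof.
move=> A B D P e m p q pb [ne [K [k [TK kerk]]]] nm; split.
  exact: (sp_stable hC pb ne nm).
by have [s [kers _]] := pullback_kernel pb nm kerk; exists K, s.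
Qed.

Definition factSystem_of_torsion (X : charTorsionTheory Z) :
    stableNormalFactSystem Z :=
  StableNormalFactSystem
    (factorisation_system_intro (ctt_factor (ctt_torsion X) (@ctt_char _ _ X))
       (ctt_orthogonal (ctt_torsion X))
       (@iso_comp_torsionEpi (torsion X))
       (@torsionfreeKernel_comp_iso (torsionfree X)))
    (fun A B f => @proj1 _ _)
    (@torsionEpi_stable (torsion X)).

(** * From factorisation systems to torsion theories *)

Definition hasArrowToTrivial (D : morphism_class (C := C)) (A : C) : Prop :=
  exists (W : C) (f : A ~> W), Z W /\ D A W f.

Section FromFactorisation.
Context (hZ : reflective Z) (E M : morphism_class (C := C)).
Context (fs : factorisation_system E M).
Context (normalE : forall (A B : C) (f : A ~> B), E f -> normalEpi Z f).
Context (stableE : pullback_stable Z E).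

Lemma hasArrowToTrivialE_replete (A B : C) (f : A ~> B) :
  isIso f -> hasArrowToTrivial E A -> hasArrowToTrivial E B.
Proof.
move=> [g [gf fg]] [W [e [ZW Ee]]]; exists W, (e ∘ g); split=> //.
by apply: (fs_compE fs) => //; apply: (fs_isoE fs); exists f.
Qed.

Lemma hasArrowToTrivialM_replete (A B : C) (f : A ~> B) :
  isIso f -> hasArrowToTrivial M A -> hasArrowToTrivial M B.
Proof.
move=> [g [gf fg]] [W [m [ZW Mm]]]; exists W, (m ∘ g); split=> //.
by apply: (fs_compM fs) => //; apply: (fs_isoM fs); exists f.
Qed.

Definition torsionOf : subcategory C := Subcategory hasArrowToTrivialE_replete.
Definition torsionfreeOf : subcategory C :=
  Subcategory hasArrowToTrivialM_replete.

Lemma kernel_torsionOf (A B : C) (e : A ~> B) :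
  E e -> torsionEpi torsionOf e.
Proof.
move=> Ee; split; first exact: normalE.
have [K [W [k [q [w [ZW nw kerk pb]]]]]] := kernel_as_pullback e.
by exists K, k; split=> //; exists W, q; split=> //; apply: stableE pb Ee nw.
Qed.

Lemma kernel_torsionfreeOf (A B : C) (m : A ~> B) :
  M m -> torsionfreeKernel torsionfreeOf m.
Proof.
move=> Mm; have [K [W [k [q [w [ZW nw kerk pb]]]]]] := kernel_as_pullback m.
exists K, k; split=> //; exists W, q; split=> //.
apply: (fs_right_orthogonal fs) => X Y e Ee.
by apply: orthogonal_pullback pb _; apply: (fs_orthogonal fs).
Qed.

(** Any two arrows [e : A ~> W] in [E] and [m : B ~> V] in [M] to trivial objects
    complete [f : A ~> B] to a square, since [m ∘ f] is trivial and hence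
    factors through the normal epimorphism [e].  Its diagonal factors [f]
    through [W]. *)
Lemma torsionOf_trivial (A B : C) (f : A ~> B) :
  torsionOf A -> torsionfreeOf B -> trivial Z f.
Proof.
move=> [W [e [ZW Ee]]] [V [m [ZV Mm]]].
have [H [h cok]] := normalE Ee.
have [|v mfE] := @cokernel_desc _ _ _ _ _ V h e (m ∘ f) cok.
  by do 2!apply: trivial_compr; apply: trivial_cod.
have [d [[<- _] _]] := fs_orthogonal fs Ee Mm (esym mfE).
by exists W, e, d.
Qed.

Lemma torsionOf_torsion_theory : torsion_theory Z torsionOf torsionfreeOf.
Proof.
split; first exact: torsionOf_trivial.
move=> X; have [W [w [ZW _]]] := reflection_cokernel hZ X.
have [I [e [m [Ee Mm _]]]] := fs_factor fs w.
have [ne [K [k [TK kerk]]]] := kernel_torsionOf Ee.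
exists K, I, k, e; split=> //; first by exists W, m.
by split=> //; apply: normalEpi_cokernel.
Qed.

(** If [k] is the kernel of [m ∘ e], then [k ∘ t] is the kernel of [e].
    Indeed [e ∘ k] goes to the kernel of [m], which is torsion-free, so it kills
    [t]; and the kernel of [e] is a torsion subobject of the domain of [k],
    hence it is contained in [t]. *)
Lemma snfs_characteristic : characteristic Z torsionOf torsionfreeOf.
Proof.
move=> A X B t g TA FB tg; split; first by exists B, g; case: tg.
move=> Y k [V [f kerk]].
have [I [e [m [Ee Mm fE]]]] := fs_factor fs f; rewrite {}fE in kerk.
have [N [n [FN kern]]] := kernel_torsionfreeOf Mm.
have [_ [S [s [TS kers]]]] := kernel_torsionOf Ee.
have [e' [ekE _]] := kernel_comp_pullback kerk kern.
exists I, e; apply: kernel_intro.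
- rewrite compA ekE -compA; apply: trivial_compl.
  exact: torsionOf_trivial.
- move=> P u v; rewrite -!compA => /(kernel_mono kerk).
  exact: (kernel_mono tg.1).
move=> P x /(kernel_lift kers) [y ->].
have [|s' ->] := @kernel_lift _ _ _ _ _ S k (m ∘ e) s kerk.
  by rewrite -compA; apply: trivial_compl kers.1.
have [s'' ->] := kernel_lift tg.1 (torsionOf_trivial (g ∘ s') TS FB).
by exists (s'' ∘ y); rewrite !compA.
Qed.

End FromFactorisation.

Definition torsion_of_factSystem (hZ : reflective Z)
    (Y : stableNormalFactSystem Z) : charTorsionTheory Z :=
  CharTorsionTheory
    (torsionOf_torsion_theory hZ (snfs_fact Y) (@snfs_normal _ _ Y)
       (@snfs_stable _ _ Y))
    (snfs_characteristic (@snfs_normal _ _ Y)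
       (@snfs_stable _ _ Y)).

(** * The two constructions are mutually inverse *)

Lemma charTorsionTheory_ext (X Y : charTorsionTheory Z) :
  torsion X = torsion Y -> torsionfree X = torsionfree Y -> X = Y.
Proof.
case: X Y => [T F tt ch] [T' F' tt' ch'] /= eqT eqF; subst T' F'.
by congr CharTorsionTheory; apply: proof_irrelevance.
Qed.

Lemma stableNormalFactSystem_ext (X Y : stableNormalFactSystem Z) :
  @classE _ _ X = @classE _ _ Y -> @classM _ _ X = @classM _ _ Y -> X = Y.
Proof.
case: X Y => [E M fs ne st] [E' M' fs' ne' st'] /= eqE eqM; subst E' M'.
by congr StableNormalFactSystem; apply: proof_irrelevance.
Qed.

Lemma kernelIn_to_trivial (S : subcategory C) (A W : C) (f : A ~> W) :
  Z W -> kernelIn S f <-> S A.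
Proof.
move=> ZW; have kerid := kernel_of_trivial (trivial_cod f ZW).
split; last by exists A, (idm A).
by move=> [K [k [SK kerk]]]; apply: kernel_replete kerk kerid SK.
Qed.

Lemma factSystem_of_torsionK (hZ : reflective Z) :
  cancel factSystem_of_torsion (torsion_of_factSystem hZ).
Proof.
move=> X; apply: charTorsionTheory_ext; apply: subcategory_ext => A /=.
- split; first by move=> [W [e [ZW [_ /(kernelIn_to_trivial _ _ ZW)]]]].
  have [W [w [ZW cokw]]] := reflection_cokernel hZ A.
  move=> TA; exists W, w; split=> //; split; first by exists A, (idm A).
  exact/(kernelIn_to_trivial _ _ ZW).
split; first by move=> [W [m [ZW /(kernelIn_to_trivial _ _ ZW)]]].
have [W [w [ZW _]]] := reflection_cokernel hZ A.
by move=> FA; exists W, w; split=> //; apply/(kernelIn_to_trivial _ _ ZW).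
Qed.

Lemma torsion_of_factSystemK (hZ : reflective Z) :
  cancel (torsion_of_factSystem hZ) factSystem_of_torsion.
Proof.
move=> Y; set Y' := factSystem_of_torsion _.
have [eqE eqM] : @classE _ _ Y = @classE _ _ Y' /\ @classM _ _ Y = @classM _ _ Y'.
  apply: factorisation_system_eq (snfs_fact Y) (snfs_fact Y') _ _ => A B f.
    exact: (kernel_torsionOf _ (@snfs_normal _ _ Y) (@snfs_stable _ _ Y)).
  exact: kernel_torsionfreeOf.
exact: stableNormalFactSystem_ext (esym eqE) (esym eqM).
Qed.

End Prenormal.

Theorem proposition5p2 (C : category) (Z : subcategory C)
    (hC : semi_prenormal Z) (hZ : reflective Z) :
  exists Phi : charTorsionTheory Z -> stableNormalFactSystem Z, bijective Phi.
Proof.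
exists (factSystem_of_torsion hC), (torsion_of_factSystem hC hZ).
  exact: factSystem_of_torsionK.
exact: torsion_of_factSystemK.
Qed.
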